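(* Assume that $\mathfrak{p}=\operatorname{non}(\mathcal{N}_{\mathrm{add}})=\mathfrak{c}$. Then there is a set $X\subseteq[\mathbb{N}]^{\infty}$ such that (1) the set $X$ is a $\mathfrak{p}$-generalized tower; (2) the set $X\cup\mathrm{Fin}$ (as a subspace of $P(\mathbb{N})$) has the property $\gamma$; (3) all continuous images of the set $X\cup\mathrm{Fin}$ into $P(\mathbb{N})$ are null-additive in $P(\mathbb{N})$, i.e., for every continuous $\varphi\colon X\cup\mathrm{Fin}\to P(\mathbb{N})$ the set $\varphi[X\cup \mathrm{Fin}]$ is null-additive; (4) the set $X$ is homeomorphic to a subset of $P(\mathbb{N})$ that is not null-additive.
   Context: $\mathbb{N}=\{1,2,\dots\}$. The power set $P(\mathbb{N})$ is identified, via characteristic functions, with the Cantor cube $\{0,1\}^{\mathbb{N}}$, and carries the corresponding topology and the standard product (fair-coin) measure; ''null'' refers to this measure. $\oplus$ is symmetric difference (coordinatewise addition mod 2). A set $X\subseteq P(\mathbb{N})$ is null-additive if for every null set $Y\subseteq P(\mathbb{N})$ the set $X\oplus Y=\{x\oplus y: x\in X, y\in Y\}$ is null. $\operatorname{non}(\mathcal{N}_{\mathrm{add}})$ is the minimal cardinality of a subset of $P(\mathbb{N})$ that is not null-additive. $\mathfrak{c}$ is the cardinality of the continuum. $[\mathbb{N}]^{\infty}$ is the family of infinite subsets of $\mathbb{N}$; $\mathrm{Fin}$ is the family of finite subsets of $\mathbb{N}$. Each $a\in[\mathbb{N}]^\infty$ is identified with its increasing enumeration, $a(n)$ being the $n$-th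 element of $a$. For natural $n<m$, $[n,m)=\{i\in\mathbb{N}: n\le i<m\}$. Write $a\subseteq^* b$ if $a\setminus b$ is finite. A pseudointersection of a family of infinite sets is an infinite set $a$ with $a\subseteq^* b$ for all $b$ in the family. A family of infinite sets is centered if all finite intersections of its elements are infinite. $\mathfrak{p}$ is the minimal cardinality of a subfamily of $[\mathbb{N}]^\infty$ that is centered and has no pseudointersection. A set $X\subseteq[\mathbb{N}]^\infty$ with $|X|\ge\mathfrak{p}$ is a $\mathfrak{p}$-generalized tower if for each $a\in[\mathbb{N}]^\infty$ there are $b\in[\mathbb{N}]^\infty$ and $S\subseteq X$ with $|S|<\mathfrak{p}$ such that $x\cap\bigcup_{n\in b}[a(n),a(n+1))\in\mathrm{Fin}$ for all $x\in X\setminus S$. A cover of a space is a family of proper subsets of the space whose union is the whole space; it is open if its members are open. A cover is an $\omega$-cover if each finite subset of the space is contained in a member of the cover, and a $\gamma$-cover if it is infinite and each point of the space belongs to all but finitely many members of the cover. A space has the property $\gamma$ if every open $\omega$-cover of the space contains a $\gamma$-cover. *)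

(* Defs.v *)
From HB Require Import structures.
From mathcomp Require Import all_boot all_order all_algebra.
From mathcomp Require Import all_classical all_reals all_analysis.

Set Implicit Arguments.
Unset Strict Implicit.
Unset Printing Implicit Defensive.

Import Order.TTheory GRing.Theory Num.Theory.
Import numFieldNormedType.Exports.

Local Open Scope classical_set_scope.
Local Open Scope card_scope.

(** P(N) is [cantor_space], i.e. [nat -> bool] with the product topology, a
    subset of N being its characteristic function.  The positive integers are
    represented by [nat] through k |-> k - 1; this bijection preserves the order,
    so intervals and increasing enumerations are unaffected. *)

Definition elems (x : cantor_space) : set nat := [set k | x k].

Definition fin_sets : set cantor_space := [set x | finite_set (elems x)].

Definition inf_sets : set cantor_space := [set x | infinite_set (elems x)].

(** A set is determined at depth [n] if membership depends only on the first [n]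
    coordinates.  The sets determined at some depth form an algebra (the clopen
    sets), which generates the Borel sets. *)
Definition determined (n : nat) (A : set cantor_space) :=
  forall x y : cantor_space, (forall i, (i < n)%N -> x i = y i) -> A x -> A y.

Definition coin_space : Type := cantor_space.
HB.instance Definition _ := Pointed.on coin_space.

Definition coin_display : measure_display. Proof. exact. Qed.

Section clopen_algebra.

Lemma determinedC n A : determined n A -> determined n (~` A).
Proof. by move=> dA x y xy nAx Ay; apply/nAx/(dA y x) => // i /xy. Qed.

Lemma determinedW m n A : (m <= n)%N -> determined m A -> determined n A.
Proof. by move=> mn dA x y xy; apply: dA => i im; apply/xy/(leq_trans im). Qed.

Lemma determinedU n A B :
  determined n A -> determined n B -> determined n (A `|` B).
Proof. by move=> dA dB x y xy [/(dA x y xy)|/(dB x y xy)]; [left|right]. Qed.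

Let clopen_sets : set (set coin_space) := [set A | exists n, determined n A].

Let clopen_sets0 : clopen_sets set0. Proof. by exists 0. Qed.

Let clopen_setsU : setU_closed clopen_sets.
Proof.
move=> A B [m dA] [n dB]; exists (maxn m n); apply: determinedU.
  exact: (determinedW (leq_maxl m n)).
exact: (determinedW (leq_maxr m n)).
Qed.

Let clopen_setsC : setC_closed clopen_sets.
Proof. by move=> A [n dA]; exists n; apply: determinedC. Qed.

HB.instance Definition _ := @isAlgebraOfSets.Build coin_display coin_space
  clopen_sets clopen_sets0 clopen_setsU clopen_setsC.

Lemma determined_measurable n (A : set coin_space) :
  determined n A -> measurable A.
Proof. by exists n. Qed.

End clopen_algebra.

Definition pad (s : seq bool) : cantor_space := fun i => nth false s i.

Definition words (A : set cantor_space) (n : nat) : nat :=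
  #|[set s : n.-tuple bool | `[< A (pad s) >]]%SET|.

(** The proportion, at a depth determining [A], of binary words whose extension
    by zeros lies in [A]; only meaningful on sets determined at some depth. *)
Definition words_measure (R : realType) (A : set coin_space) : \bar R :=
  let n := xget 0 [set n | determined n A] in ((words A n)%:R / 2 ^+ n)%:E.

Section words_measure.
Context (R : realType).
Local Open Scope ring_scope.

Lemma wordsS n A : determined n A -> words A n.+1 = (2 * words A n)%N.
Proof.
move=> dA; rewrite /words.
pose f (p : bool * n.-tuple bool) : n.+1.-tuple bool := [tuple of rcons p.2 p.1].
have finj : injective f.
  by move=> [b s] [b' s'] /(congr1 val) /= /rcons_inj [/val_inj -> ->].
have pad_rcons b (s : n.-tuple bool) i : (i < n)%N ->
    pad (rcons s b) i = pad s i.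
  by move=> lt_in; rewrite /pad nth_rcons size_tuple lt_in.
rewrite -[2%N]card_bool -[#|{: bool}|]cardsT -cardsX -(card_imset _ finj).
apply: eq_card => -[t ts]; rewrite !inE /=; apply/idP/imsetP.
- case/lastP: t ts => // s b ts.
  have szs : size s == n by move: (ts); rewrite size_rcons eqSS.
  move=> /asboolP As; exists (b, Tuple szs); last exact/val_inj.
  rewrite !inE; apply: dA As => i.
  exact: (pad_rcons b (Tuple szs)).
- case=> -[b s]; rewrite !inE => As [->].
  by apply: dA As => i /(pad_rcons b s) ->.
Qed.

Lemma words_det m n A : determined m A -> (m <= n)%N ->
  ((words A n)%:R / 2 ^+ n : R) = (words A m)%:R / 2 ^+ m.
Proof.
move=> dA; elim: n => [|n IHn]; first by rewrite leqn0 => /eqP ->.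
rewrite leq_eqVlt => /predU1P[<- //|]; rewrite ltnS => mn.
rewrite (wordsS (determinedW mn dA)) -IHn // natrM exprS invfM mulrACA.
by rewrite divff ?mul1r // pnatr_eq0.
Qed.

Lemma words_measureE n A : determined n A ->
  words_measure R A = ((words A n)%:R / 2 ^+ n)%:E.
Proof.
move=> dA; rewrite /words_measure; set m := xget _ _.
have dm : determined m A.
  by apply: (@xgetPex _ 0%N [set n | determined n A]); exists n.
congr (_%:E); rewrite -(words_det dm (leq_maxl m n)).
by rewrite (words_det dA) // leq_maxr.
Qed.

Lemma words_measure0 : words_measure R set0 = 0%E.
Proof.
rewrite (@words_measureE 0 set0) // /words (_ : [set _ | _]%SET = finset.set0).
  by rewrite cards0 mul0r.
by apply/setP => s; rewrite !inE; apply/asboolP.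
Qed.

Lemma words_measure_ge0 A : (0 <= words_measure R A)%E.
Proof. by rewrite lee_fin divr_ge0 // exprn_ge0. Qed.

Lemma words_measureU n A B : determined n A -> determined n B ->
  A `&` B = set0 ->
  words_measure R (A `|` B) = (words_measure R A + words_measure R B)%E.
Proof.
move=> dA dB AB0; rewrite !(@words_measureE n) //; last exact: determinedU.
rewrite -EFinD -mulrDl -natrD; congr ((_%:R / _)%:E).
rewrite /words -cardsUI [X in (_ + #|pred_of_set X|)%N](_ : _ = finset.set0).
  rewrite cards0 addn0; apply: eq_card => s; rewrite !inE.
  by apply/asboolP/orP => -[] /asboolP; [left|right|left|right]; rewrite // asboolE.
apply/setP => s; rewrite !inE -asbool_and; apply/asboolP => ABs.
by have : (A `&` B) (pad s) by []; rewrite AB0.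
Qed.

Lemma determined_open n A : determined n A -> open A.
Proof.
move=> dA; rewrite openE => x Ax.
have near_eq i : \forall y \near x, y i = x i.
  apply: (@proj_continuous nat (fun=> bool) i x [set b | b = x i]).
  exact: (open_nbhs_nbhs (conj (discrete_open _) _)).
suff : \forall y \near x, forall i, (i < n)%N -> y i = x i.
  by apply: filterS => y xy; apply: dA Ax => i /xy.
elim: n {dA} => [|n IHn]; first by apply: filterE => y i.
apply: filterS2 (near_eq n) IHn => y yn yx i.
by rewrite ltnS leq_eqVlt => /predU1P[->|/yx].
Qed.

Lemma words_measure_semi_sigma_additive :
  semi_sigma_additive (words_measure R : set coin_space -> \bar R).
Proof.
move=> F mF tF [n dU]; pose U := \bigcup_k F k.
have oF k : open (F k : set cantor_space).
  by have [m /determined_open] := mF k.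
have cU : cover_compact (U : set cantor_space).
  rewrite -compact_cover.
  apply: (subclosed_compact _ cantor_space_compact) => //.
  rewrite -openC; apply/determined_open/determinedC/dU.
have [//|D _ sUD] := cU nat setT F (fun k _ => oF k).
pose N := (\max_(k <- finmap.enum_fset D) k.+1)%N.
have F0 k : (N <= k)%N -> F k = set0.
  move=> Nk; rewrite -subset0 => x Fkx; have [|i /= Di Fix] := sUD x; first by exists k.
  have ltik : (i < k)%N by apply: leq_trans Nk; exact: (@leq_bigmax_seq _ _ xpredT S).
  by move: ltik; rewrite (tF i k) ?ltnn //; exists x.
have [m dm] : exists m, forall k, determined m (F k).
  have [f df] := boolp.choice mF.
  exists (\max_(k < N) f k)%N => k.
  have [Nk|kN] := leqP N k; first by rewrite F0.
  by apply: determinedW (df k); apply: (leq_bigmax (Ordinal kN)).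
have dS j : determined m (\big[setU/set0]_(i < j) F i).
  elim: j => [|j IHj]; first by rewrite big_ord0.
  by rewrite big_ord_recr; apply: determinedU.
have addS j : (\sum_(0 <= i < j) words_measure R (F i))%E =
    words_measure R (\big[setU/set0]_(i < j) F i).
  rewrite big_mkord; elim: j => [|j IHj].
    by rewrite !big_ord0 words_measure0.
  rewrite !big_ord_recr /= IHj -(@words_measureU m) //.
  rewrite -bigcup_mkord -subset0 => x [[i /= ij Fix] Fjx].
  by move: ij; rewrite (tF i j) ?ltnn //; exists x.
apply: cvg_near_cst; exists N => // j /= Nj.
rewrite addS; congr words_measure; rewrite -bigcup_mkord; apply/seteqP; split.
  by move=> x [i _ Fix]; exists i.
move=> x [i _ Fix]; exists i => //=; rewrite ltnNge; apply/negP => ji.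
by move: Fix; rewrite F0 // (leq_trans Nj).
Qed.

HB.instance Definition _ := isMeasure.Build coin_display coin_space R
  (words_measure R) words_measure0 words_measure_ge0
  words_measure_semi_sigma_additive.

End words_measure.

Definition fair_coin (R : realType) :
    set (g_sigma_algebraType (@measurable coin_display coin_space)) -> \bar R :=
  measure_extension (words_measure R).

Lemma fair_coin_cylinder (R : realType) (s : seq bool) :
  fair_coin R [set x | forall i, (i < size s)%N -> x i = nth false s i] =
  (2 ^- size s)%:E.
Proof.
set A : set cantor_space := [set x | _].
have dA : determined (size s) A.
  by move=> x y xy Ax i lt_is; rewrite -xy // Ax.
rewrite /fair_coin /measure_extension measurable_mu_extE; last first.
  exact: determined_measurable dA.
rewrite /= (words_measureE R dA) /words.
rewrite (_ : [set _ | _]%SET = finset.set1 (in_tuple s)) ?cards1 ?div1r //.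
apply/setP => t; rewrite !inE; apply/asboolP/eqP => [At|->]; last by move.
apply/val_inj/(@eq_from_nth _ false); rewrite ?size_tuple // => i lt_is.
Qed.

Definition null (R : realType) (Y : set cantor_space) : Prop :=
  (fair_coin R).-negligible Y.

Definition symdiff (x y : cantor_space) : cantor_space :=
  fun k => x k (+) y k.

Definition null_additive (R : realType) (X : set cantor_space) :=
  forall Y, null R Y -> null R [set symdiff x y | x in X & y in Y].

(** A cardinal number is represented by a set of that cardinality: [min_card P]
    is a set in [P] of least cardinality. It exists as soon as [P] is nonempty,
    cardinals being well-ordered. *)
Definition min_card (T : Type) (P : set (set T)) : set T :=
  get [set A | P A /\ forall B, P B -> A #<= B].

Definition continuum : set cantor_space := [set: cantor_space].

Definition non_null_additive (R : realType) : set cantor_space :=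
  min_card [set X | ~ null_additive R X].

Definition almost_subset (a b : cantor_space) := finite_set (elems a `\` elems b).

Definition pseudointersection (F : set cantor_space) (a : cantor_space) :=
  inf_sets a /\ forall b, F b -> almost_subset a b.

Definition centered (F : set cantor_space) :=
  forall G : set cantor_space, G `<=` F -> finite_set G ->
    infinite_set (\bigcap_(x in G) elems x).

Definition pseudointersection_number : set cantor_space :=
  min_card [set F | [/\ F `<=` inf_sets, centered F &
                        ~ exists a, pseudointersection F a]].

(** The element of [a] that has exactly [n] elements of [a] below it. *)
Definition enum_elems (a : cantor_space) (n : nat) : nat :=
  get [set k | a k /\ count a (iota 0 k) = n].

Lemma count_iotaD (a : pred nat) (k d : nat) :
  count a (iota 0 (k.+1 + d)) =
  (count a (iota 0 k) + a k + count a (iota k.+1 d))%N.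
Proof. by rewrite iotaD count_cat -addn1 iotaD count_cat /= add0n addn0. Qed.

Lemma enum_elems_count (a : cantor_space) (k : nat) :
  a k -> enum_elems a (count a (iota 0 k)) = k.
Proof.
move=> ak; apply: xget_unique => [//|k' [ak' eq_count]].
have count_lt i j : a i -> (i < j)%N ->
    (count a (iota 0 i) < count a (iota 0 j))%N.
  by move=> ai ij; rewrite -(subnKC ij) count_iotaD ai addn1 leq_addr.
case: (ltngtP k' k) => // [/(count_lt _ _ ak')|/(count_lt _ _ ak)].
  by rewrite eq_count ltnn.
by rewrite eq_count ltnn.
Qed.

Lemma enum_elemsP (a : cantor_space) (n : nat) : inf_sets a ->
  a (enum_elems a n) /\ count a (iota 0 (enum_elems a n)) = n.
Proof.
move=> inf_a; apply: (@xgetPex _ point [set k | a k /\ count a (iota 0 k) = n]).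
suff [k /eqP nk ak] : exists2 k, count a (iota 0 k) == n & a k by exists k.
elim: n => [|n [k /eqP nk ak]].
  have [k ak] : exists k, a k.
    by apply: contrapT => na; apply: inf_a; rewrite (_ : elems a = set0) //;
      rewrite -subset0 => k ak; apply: na; exists k.
  case: (ex_minnP (ex_intro _ k ak)) => m am min_m; exists m => //.
  rewrite -leqn0 leqNgt -has_count; apply/hasPn => i.
  by rewrite mem_iota add0n /= => im; apply: contraL im => /min_m; rewrite -leqNgt.
have [j /andP[kj aj]] : exists j, (k < j)%N && a j.
  apply: contrapT => na; apply: inf_a; apply: sub_finite_set (finite_II k.+1).
  move=> i ai /=; rewrite ltnS leqNgt; apply/negP => ki.
  by apply: na; exists i; rewrite ki.
have [m /andP[km am] min_m] := ex_minnP (ex_intro (fun j => _ && _) j (introT andP (conj kj aj))).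
exists m => //; rewrite -(subnKC km) count_iotaD nk ak addn1.
rewrite (_ : count _ _ = 0%N) ?addn0 //; apply/eqP.
rewrite -leqn0 leqNgt -has_count; apply/hasPn => i.
rewrite mem_iota (subnKC km) => /andP[ki im].
by apply: contraL im => ai; rewrite -leqNgt min_m // ki.
Qed.

Definition blocks (a b : cantor_space) : set nat :=
  \bigcup_(n in elems b)
    [set i | (enum_elems a n <= i < enum_elems a n.+1)%N].

Definition p_generalized_tower (X : set cantor_space) :=
  [/\ X `<=` inf_sets,
      pseudointersection_number #<= X &
      forall a, inf_sets a -> exists b, exists S : set cantor_space,
        [/\ inf_sets b, S `<=` X, ~ (pseudointersection_number #<= S) &
            forall x, (X `\` S) x -> finite_set (elems x `&` blocks a b)]].

Section covers.
Context (T : topologicalType).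
Implicit Types U V : set (set T).

Definition is_cover U :=
  (forall A, U A -> A != [set: T]) /\ \bigcup_(A in U) A = [set: T].

Definition open_cover U := is_cover U /\ forall A, U A -> open A.

Definition omega_cover U :=
  is_cover U /\
  forall E : set T, finite_set E -> exists2 A, U A & E `<=` A.

Definition gamma_cover U :=
  [/\ is_cover U, infinite_set U &
      forall x : T, finite_set [set A | U A /\ ~ A x]].

End covers.

Definition property_gamma (T : topologicalType) :=
  forall U : set (set T), open_cover U -> omega_cover U ->
    exists2 V, V `<=` U & gamma_cover V.

Definition homeomorphic (T U : topologicalType) :=
  exists (f : T -> U) (g : U -> T),
    [/\ continuous f, continuous g, cancel f g & cancel g f].

(* Main.v *)
Require Import Defs.
From HB Require Import structures.
From mathcomp Require Import all_boot all_order all_algebra.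
From mathcomp Require Import all_classical all_reals all_analysis.
From mathcomp Require Import zify.

(** By transfinite recursion along a well-order of the continuum we build a
    tower [t_c] of infinite sets, decreasing modulo finite, whose gaps grow
    faster than a function prescribed at stage [c]; this uses that a centered family
    of fewer than [p] sets has a pseudointersection. The elements of [X] are
    [x_c = {2 t_c(n) + y_c(n) | n}], where [y_c] runs over all of [P(N)], so
    for every stage [c] all but fewer than [p] elements of [X] are almost
    contained in the doubling of [t_c].

    - Every open omega-cover has a countable refinement by clopen sets. At the
      stage coding it, [p] yields a gamma-sequence for the earlier points, and
      the gaps of [t_c] are chosen so large that membership of [x] in the next
      term depends only on the finite part of [x] before the gap.
    - Let [phi] be continuous and [Y] null, say contained in the limsup of
      clopen sets [D_k] of measure at most [8^-k]. If the gaps of [t_c] outgrow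
      a modulus of continuity of [phi] at the finite sets, then the relevant
      bits of [phi x] take only [O(4^k)] values at level [k], so the sum is
      null by Borel-Cantelli. The fewer than [non(N_add)] remaining points are
      harmless.
    - The parities of the increasing enumeration form a continuous map from
      [X] onto [P(N)]; its graph is homeomorphic to [X] and not null-additive.
*)

Set Implicit Arguments.
Unset Strict Implicit.
Unset Printing Implicit Defensive.

Local Open Scope classical_set_scope.
Local Open Scope card_scope.

(** * Cardinal arithmetic *)

Lemma card_le_injP (T : Type) (U : pointedType) (A : set T) (B : set U) :
  A #<= B <-> exists2 f : T -> U, {in A &, injective f} & f @` A `<=` B.
Proof.
split=> [/pcard_leP[f]|[f finj fAB]].
  by exists f => [|_ [x Ax <-]]; [exact: inj|exact: funS].
rewrite -(card_le_eql (inj_card_eq finj)); exact: subset_card_le.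
Qed.

(* Hoenig: a maximal set of choice functions on [P] with injective coordinates
   surjects onto some coordinate. *)
Lemma min_card_le (T : Type) (P : set (set T)) (B : set T) :
  P B -> min_card P #<= B.
Proof.
move=> PB; suff : exists A, P A /\ forall B, P B -> A #<= B.
  by case=> A minA; rewrite /min_card; case: xgetP => [C -> [_]|/(_ A)];
    first exact.
pose good (Y : set (set T -> T)) :=
  (forall f A, Y f -> P A -> A (f A)) /\
  (forall f g A, Y f -> Y g -> P A -> f A = g A -> f = g).
have [|Y [[Yin Yinj] maxY]] := @Zorn_bigcup _ good.
  move=> F Fgood Ftot; split=> [f A [Y FY Yf]|f g A [Y FY Yf] [Z FZ Zg] PA].
    by have [mem _] := Fgood _ FY; exact: mem.
  have [YZ|ZY] := Ftot _ _ FY FZ.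
    by have [_ inj] := Fgood _ FZ; apply: (inj _ _ A) => //; exact: YZ.
  by have [_ inj] := Fgood _ FY; apply: (inj _ _ A) => //; exact: ZY.
(* If the values of [Y] exhaust some [A] in [P], then [A] injects into [Y], and [Y] injects into
   every member of [P] by evaluation there. Otherwise a choice of missed values enlarges [Y]. *)
have [[A [PA Asurj]]|noA] :=
    pselect (exists A, P A /\ forall a, A a -> exists2 f, Y f & f A = a).
  exists A; split=> // C PC; apply: (@card_le_trans _ _ _ Y).
    apply: card_le_trans (card_image_le (fun f => f A) Y).
    by apply: subset_card_le => a /Asurj[f Yf <-]; exists f.
  have e : (fun f => f C) @` Y #= Y.
    by apply: inj_card_eq => f g /set_mem Yf /set_mem Yg; apply: (Yinj f g C).
  rewrite -(card_le_eql e).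
  by apply: subset_card_le => _ [f Yf <-]; exact: (Yin f C).
have ex (a0 : T) A : exists a : T, P A -> A a /\ forall f, Y f -> f A <> a.
  have [PA|nPA] := pselect (P A); last by exists a0.
  have [[a [Aa na]]|nex] := pselect (exists a, A a /\ forall f, Y f ->
    f A <> a).
    by exists a.
  exfalso; apply: noA; exists A; split=> // a Aa; apply: contrapT => nf.
  by apply: nex; exists a; split=> // f Yf fAa; apply: nf; exists f.
have [b0 _] : exists b, B b.
  apply: contrapT => B0; apply: noA; exists B; split=> // b Bb.
  by case: B0; exists b.
have [g gP] := boolp.choice (ex b0).
exfalso; apply: (maxY (Y `|` [set g])).
  split=> [f Yf|]; first by left.
  by move=> /(_ g (or_intror erefl)) Yg; have [_ /(_ g Yg)] := gP _ PB.
split=> [f A [Yf|->] PA|f f' A [Yf|->] [Yf'|->] PA ff'] //.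
- exact: (Yin f A).
- by have [] := gP _ PA.
- exact: Yinj ff'.
- by have [_ /(_ f Yf)] := gP _ PA.
- by have [_ /(_ f' Yf')] := gP _ PA; rewrite ff'.
Qed.

Definition interleave (x y : cantor_space) : cantor_space :=
  fun n => if odd n then y n./2 else x n./2.

Lemma interleave_even x y n : interleave x y n.*2 = x n.
Proof. by rewrite /interleave odd_double doubleK. Qed.

Lemma interleave_odd x y n : interleave x y n.*2.+1 = y n.
Proof. by rewrite /interleave /= odd_double /= uphalf_double. Qed.

Lemma interleave_inj x y x' y' :
  interleave x y = interleave x' y' -> x = x' /\ y = y'.
Proof.
move=> e; split; apply/funext => n.
  by rewrite -(interleave_even x y) e interleave_even.
by rewrite -(interleave_odd x y) e interleave_odd.
Qed.

Lemma continuum_uncountable : ~ countable continuum.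
Proof.
move=> /countable_injP[f finj].
pose d : cantor_space := fun n => `[< forall x : cantor_space, f x = n ->
  ~~ x n >].
have dE x : f x = f d -> x = d by move=> e; apply: finj; rewrite ?inE.
have [dfd|dfd] := boolP (d (f d)).
  by move/asboolP: (dfd) => /(_ d erefl); rewrite dfd.
by move: (dfd) => /asboolP; apply=> x /dE ->.
Qed.

(* The continuum splits into continuum many uncountable fibres. *)
Lemma card_continuumU (Z C : set cantor_space) : countable C ->
  continuum #<= Z `|` C -> continuum #<= Z.
Proof.
move=> cC /card_le_injP[g ginj gZC].
have ginjT x y : g x = g y -> x = y by apply: ginj; rewrite inE.
have ex y : exists v, Z (g (interleave y v)).
  apply: contrapT => nv; apply: continuum_uncountable.
  apply: sub_countable cC; apply/card_le_injP.
  exists (fun v => g (interleave y v)).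
    by move=> v v' _ _ /ginjT /interleave_inj[].
  move=> _ [v _ <-].
  have : (Z `|` C) (g (interleave y v)) by apply: gZC; exists (interleave y v).
  by case=> // Zv; case: nv; exists v.
have [v vP] := boolp.choice ex; apply/card_le_injP.
exists (fun y => g (interleave y (v y))); last by move=> _ [y _ <-].
by move=> y y' _ _ /ginjT /interleave_inj[].
Qed.

(** An arbitrary well-order may have large initial segments. If so, take the least [m] with
    continuum many predecessors and pull the order back along an injection into these. *)
Lemma continuum_well_order : exists lt : cantor_space -> cantor_space -> Prop,
  [/\ well_founded lt, forall x y z, lt x y -> lt y z -> lt x z,
      forall x y, [\/ lt x y, x = y | lt y x] &
      forall x, ~ (continuum #<= [set y | lt y x])].
Proof.
have [R Rwo] := wochoice.well_ordering_principle cantor_space.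
have Rtot x y : R x y || R y x.
  have [//|z [[zxy minz] _]] := Rwo [pred z | (z == x) || (z == y)].
    by exists x; rewrite inE eqxx.
  move: zxy; rewrite inE => /orP[]/eqP zE; subst z; apply/orP; [left|right].
    by apply: minz; rewrite inE eqxx orbT.
  by apply: minz; rewrite inE eqxx.
have Ranti x y : R x y -> R y x -> x = y.
  move=> xy yx; have [|z [_ uz]] := Rwo [pred z | (z == x) || (z == y)].
    by exists x; rewrite inE eqxx.
  have RR u : R u u by have := Rtot u u; rewrite orbb.
  rewrite -(uz x) ?(uz y) //; split; rewrite ?inE ?eqxx ?orbT // => u;
    by rewrite inE => /orP[]/eqP->.
pose lt0 x y := R x y /\ x <> y.
have min (A : set cantor_space) : A !=set0 ->
    exists2 m, A m & forall x, A x -> ~ lt0 x m.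
  move=> [a Aa]; have [|z [[Az minz] _]] := Rwo [pred x | x \in A].
    by exists a; rewrite !inE.
  exists z; first by move: Az; rewrite !inE.
  by move=> x Ax [xz]; apply; apply: Ranti => //; apply: minz; rewrite !inE.
have tot0 x y : [\/ lt0 x y, x = y | lt0 y x].
  have [->|xy] := pselect (x = y); first exact: Or32.
  by have /orP[?|?] := Rtot x y; [apply: Or31|apply: Or33; split=> // /esym].
have wf0 : well_founded lt0.
  move=> x; apply: contrapT => nx;
    have [m nm mmin] := min _ (ex_intro [set x | ~ Acc lt0 x] x nx).
  by apply: nm; constructor => y ym; apply: contrapT => /mmin.
have trans0 x y z : lt0 x y -> lt0 y z -> lt0 x z.
  move=> xy yz; have [//|xz|zx] := tot0 x z.
    by case: yz xy => yz _ [xy] []; apply: Ranti => //; rewrite xz.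
  have [|m] := min [set u | [\/ u = x, u = y | u = z]]; first by exists x;
    apply: Or31.
  by case=> -> mm; exfalso; [apply: (mm z)|apply: (mm x)|apply: (mm y)] => //;
    constructor.
have [[m0 big0]|small] :=
    pselect (exists x, continuum #<= [set y | lt0 y x]); last first.
  by exists lt0; split=> // x bigx; apply: small; exists x.
have [m /= /card_le_injP[g ginj gm] mmin] :=
  min _ (ex_intro (fun x => continuum #<= [set y | lt0 y x]) m0 big0).
exists (fun x y => lt0 (g x) (g y)); split.
- suff acc v u : g u = v -> Acc (fun x y => lt0 (g x) (g y)) u.
    by move=> u; exact: (acc (g u)).
  elim/(well_founded_ind wf0): v u => v IH u gu; constructor => w wu.
  by apply: (IH (g w)) => //; rewrite -gu.
- by move=> x y z; exact: trans0.
- move=> x y; have [?|/ginj->//|?] := tot0 (g x) (g y); rewrite ?inE //.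
  + exact: Or31.
  + exact: Or32.
  + exact: Or33.
- move=> x big; apply: (mmin (g x)); last by apply: gm; exists x.
  apply: card_le_trans big _; apply/card_le_injP; exists g.
    by move=> u v _ _; apply: ginj; rewrite inE.
  by move=> _ [y yx <-].
Qed.

(** * Subsets of the natural numbers and clopen sets *)

Lemma finite_natP (A : set nat) :
  finite_set A <-> exists n, forall k, A k -> (k < n)%N.
Proof.
split=> [/finite_seqP[s As]|[n An]].
  exists (\max_(k <- s) k.+1)%N => k; rewrite As /= => ks.
  exact: (@leq_bigmax_seq _ _ xpredT S).
by apply: sub_finite_set (finite_II n) => k /An.
Qed.

Lemma infinite_natP (A : set nat) :
  infinite_set A <-> forall n, exists2 k, (n <= k)%N & A k.
Proof.
split=> [infA n|Aex /finite_natP[n An]].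
  apply: contrapT => nk; apply: infA; apply/finite_natP; exists n => k Ak.
  by rewrite ltnNge; apply/negP => nlek; apply: nk; exists k.
by have [k nk /An] := Aex n; rewrite ltnNge nk.
Qed.

Lemma almost_subsetP (a b : cantor_space) :
  almost_subset a b <-> exists n, forall k, (n <= k)%N -> a k -> b k.
Proof.
split=> [/finite_natP[n abn]|[n abn]].
  exists n => k nk ak; apply: contrapT => /negP nbk.
  by have := abn k (conj ak (negP nbk)); rewrite ltnNge nk.
apply/finite_natP; exists n => k [ak nbk]; rewrite ltnNge; apply/negP => nk.
by apply: nbk; exact: abn.
Qed.

Lemma almost_subset_trans (a b c : cantor_space) :
  almost_subset a b -> almost_subset b c -> almost_subset a c.
Proof.
move=> /almost_subsetP[m ab] /almost_subsetP[n bc]; apply/almost_subsetP.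
by exists (maxn m n) => k; rewrite geq_max => /andP[mk nk] /ab-/(_ mk)/bc;
  exact.
Qed.

Lemma open_cylinder (O : set cantor_space) (x : cantor_space) :
  open O -> O x -> exists n, forall y : cantor_space, (forall i,
    (i < n)%N -> y i = x i) -> O y.
Proof.
move=> oO Ox; apply: contrapT => nex.
have ex n : exists y : cantor_space, (forall i, (i < n)%N ->
  y i = x i) /\ ~ O y.
  apply: contrapT => ny; apply: nex; exists n => y yx; apply: contrapT => nOy.
  by apply: ny; exists y.
have [y yP] := boolp.choice ex.
have yx : {ptws, y @ \oo --> x}.
  apply/pointwise_cvgP => i; change ((y n i) @[n --> \oo] --> x i).
  apply: cvg_near_cst; near=> n.
  have [yx _] := yP n; apply: yx; near: n; exact: nbhs_infty_gt.
have [n _ /(_ n (leqnn n))] := yx O (open_nbhs_nbhs (conj oO Ox)).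
by have [_] := yP n.
Unshelve. all: by end_near. Qed.

Definition cut (n : nat) (x : cantor_space) : cantor_space :=
  fun i => (i < n)%N && x i.

Definition below (n : nat) : set cantor_space :=
  [set x | forall i, x i -> (i < n)%N].

Lemma cut_below n x : below n (cut n x).
Proof. by move=> i /andP[]. Qed.

Lemma below_fin n : below n `<=` fin_sets.
Proof. by move=> x xn; apply/finite_natP; exists n. Qed.

Lemma fin_below x : fin_sets x -> exists n, below n x.
Proof. by move=> /finite_natP. Qed.

Lemma below_pad n : below n `<=` [set pad s | s in [set: n.-tuple bool]].
Proof.
move=> x xn; exists (mktuple (fun i : 'I_n => x i)) => //; apply/funext => i;
  rewrite /pad.
have [ltin|nlei] := ltnP i n.
  by rewrite -[i in LHS]/(nat_of_ord (Ordinal ltin)) -tnth_nth tnth_mktuple.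
rewrite nth_default ?size_tuple //; apply/esym/negP => /xn.
by rewrite ltnNge nlei.
Qed.

Lemma finite_below n : finite_set (below n).
Proof. exact: sub_finite_set (@below_pad n) (finite_image _ finite_finset). Qed.

Lemma countable_fin_sets : countable fin_sets.
Proof.
have -> : fin_sets = \bigcup_n below n.
  by apply/seteqP; split=> [x /fin_below[n xn]|x [n _ /below_fin]];
    first exists n.
apply: bigcup_countable => // n _; exact: finite_set_countable (finite_below n).
Qed.

(* [(n, s)] codes the clopen set of all [x] whose first [n] values are listed in
   [s]. *)
Definition clopen_of (p : nat * seq (seq bool)) : set cantor_space :=
  [set x | mkseq x p.1 \in p.2].

Lemma mkseq_eq n (x y : cantor_space) :
  (forall i, (i < n)%N -> x i = y i) -> mkseq x n = mkseq y n.
Proof.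
move=> xy; apply: (@eq_from_nth _ false); rewrite ?size_mkseq // => i ltin.
by rewrite !nth_mkseq ?xy.
Qed.

Lemma determined_clopen_of p : determined p.1 (clopen_of p).
Proof. by move=> x y /mkseq_eq xy; rewrite /clopen_of /= xy. Qed.

Lemma clopen_between (E O : set cantor_space) :
  finite_set E -> open O -> E `<=` O ->
  exists p, E `<=` clopen_of p /\ clopen_of p `<=` O.
Proof.
move=> /finite_seqP[s ->] oO; elim: s => [|x s IHs] sO.
  by exists (0%N, [::]); split.
have [|[n w] [sw wO]] := IHs.
  by move=> y ys; apply: sO; rewrite /= inE (ys : y \in s) orbT.
have [m mO] := open_cylinder oO (sO x (mem_head x s)).
pose N := maxn n m.
exists (N, [seq mkseq y N | y : cantor_space <- x :: s]); split=> y /=.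
  by move=> ys; exact: (map_f (fun z : cantor_space => mkseq z N) ys).
rewrite /clopen_of /=; rewrite -[_ :: map _ _]/(map (fun z => mkseq z N) (x ::
  s)).
move=> /mapP[z zs yz]; have {}yz i : (i < N)%N -> y i = z i.
  by move=> iN; rewrite -(nth_mkseq false y iN) yz nth_mkseq.
move: zs; rewrite inE => /orP[/eqP zx|zs].
  by apply: mO => i im; rewrite -zx yz // (leq_trans im) // leq_maxr.
apply: wO; apply: (@determined_clopen_of (n, w) z) (sw z zs) => i ni.
by rewrite yz // (leq_trans ni) // leq_maxl.
Qed.

(** Lets a single point of the continuum name all the data prescribed at a stage of the
    recursion. *)
Lemma code_surjective (K : countType) :
  exists dec : cantor_space -> K -> bool, forall g, exists c, dec c = g.
Proof.
exists (fun c k => c (pickle k)) => g.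
exists (fun n => if unpickle n is Some k then g k else false).
by apply/funext => k; rewrite pickleK.
Qed.

Lemma eventually_finite (T : Type) (E : set T) (P : nat -> T -> Prop) :
  finite_set E -> (forall x, E x -> exists n, forall k, (n <= k)%N -> P k x) ->
  exists n, forall k, (n <= k)%N -> forall x, E x -> P k x.
Proof.
move=> finE; elim/Peq : T => T in E P finE *.
move: finE => /finite_seqP[s ->]; elim: s => [|y s IHs] sP; first by exists 0%N.
have [x xs|n nP] := IHs; first by apply: sP; rewrite /= inE (xs : x \in s) orbT.
have [m mP] := sP y (mem_head y s).
exists (maxn m n) => k; rewrite geq_max => /andP[mk nk] x.
by rewrite /= inE => /orP[/eqP ->|xs]; [exact: mP|exact: nP].
Qed.

(** Transfinite recursion in which each value is chosen under a condition on the earlier ones. By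
    the second hypothesis [G a] sees only values before [a], so the recursion may fill in [point]
    elsewhere. *)
Lemma wf_choice (A : Type) (B : pointedType) (lt : A -> A -> Prop)
    (G : A -> (A -> B) -> B -> Prop) :
  well_founded lt ->
  (forall a f g b, (forall c, lt c a -> f c = g c) -> G a f b -> G a g b) ->
  (forall a f, (forall c, lt c a -> G c f (f c)) -> exists b, G a f b) ->
  exists f, forall a, G a f (f a).
Proof.
move=> lt_wf Gext Gex.
pose F a (rec : forall c, lt c a -> B) : B :=
  get (G a (fun c => if pselect (lt c a) is left h then rec c h else point)).
pose f := Fix lt_wf (fun=> B) F.
have fE a : f a = F a (fun c _ => f c).
  rewrite /f Fix_eq // => x g h gh; congr F.
  by apply: functional_extensionality_dep => c;
    apply: functional_extensionality_dep.
exists f; elim/(well_founded_ind lt_wf) => a IH.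
rewrite fE /F; set g := fun c => _.
have fg c : lt c a -> f c = g c by rewrite /g; case: pselect.
have [b Gb] := Gex a f IH; apply: (Gext a g) => [c /fg ->//|].
by apply: (@getPex _ (G a g)); exists b; apply: Gext Gb.
Qed.

(** * Pseudointersections, gamma-sequences and one stage of the recursion *)

Lemma pseudointersection_exists (F : set cantor_space) :
  F `<=` inf_sets -> centered F -> ~ (pseudointersection_number #<= F) ->
  exists a, pseudointersection F a.
Proof. by move=> Finf Fc small; apply: contrapT => na;
  apply/small/min_card_le. Qed.

(** The omega-cover condition in terms of codes: these form a countable type, so [W] can be encoded
    in a point of the continuum. *)
Definition omega_codes (Z : set cantor_space) (W : set (nat * seq (seq bool)))
  :=
  forall E, finite_set E -> E `<=` Z -> exists2 p, W p & E `<=` clopen_of p.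

Definition eventually_in (p : nat -> nat * seq (seq bool)) (x : cantor_space) :=
  exists n, forall k, (n <= k)%N -> clopen_of (p k) x.

(** The classical argument that spaces smaller than [p] have the property gamma: the sets [B z] of
    codes capturing [z] are centered, and a pseudointersection of them lists the sequence. *)
Lemma small_gamma (Z : set cantor_space) (W : set (nat * seq (seq bool))) :
  Z !=set0 -> ~ (pseudointersection_number #<= Z) -> omega_codes Z W ->
  exists p, (forall k, W (p k)) /\ forall z, Z z -> eventually_in p z.
Proof.
move=> [z0 Zz0] Zsmall WZ.
(* The extra number in [q] repeats every code infinitely often, so one code common to finitely many
   points already makes the intersection infinite. *)
pose B (z : cantor_space) : cantor_space := fun n =>
  `[< exists q : nat * (nat * seq (seq bool)), [/\ n = pickle q,
    W q.2 & clopen_of q.2 z] >].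
have Bcent : centered (B @` Z).
  move=> G GB finG; have ex a : exists z, G a -> Z z /\ B z = a.
    have [Ga|nGa] := pselect (G a); last by exists z0.
    by have [z Zz <-] := GB a Ga; exists z.
  have [g gP] := boolp.choice ex.
  have [|_ [a Ga <-]|p Wp Ep] := WZ (g @` G); first exact: finite_image.
    by have [] := gP a Ga.
  apply: (@sub_infinite_set _ (range (fun j => pickle (j, p)))).
    move=> _ [j _ <-] a Ga; have [_ <-] := gP a Ga.
    by apply/asboolP; exists (j, p); split=> //; apply: Ep; exists a.
  rewrite (eq_finite_set (inj_card_eq _)); first exact: infinite_nat.
  by move=> i j _ _ /(pcan_inj pickleK) [].
have Binf : B @` Z `<=` inf_sets.
  move=> b Bb; have := Bcent [set b].
  rewrite bigcap_set1; apply; [by move=> _ -> | exact: finite_set1].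
have Bsmall : ~ (pseudointersection_number #<= B @` Z).
  by move=> h; apply: Zsmall; apply: card_le_trans h (card_image_le _ _).
have [a [/infinite_natP infa aB]] :=
  pseudointersection_exists Binf Bcent Bsmall.
have ex k : exists q : nat * (nat * seq (seq bool)),
    [/\ (k <= pickle q)%N, a (pickle q) & W q.2].
  have /almost_subsetP[n aB0] := aB _ (imageP B Zz0).
  have [m] := infa (maxn k n); rewrite geq_max => /andP[km nm] am.
  by have /asboolP[q [mq Wq _]] := aB0 m nm am; exists q; rewrite -mq.
have [q qP] := boolp.choice ex.
exists (fun k => (q k).2); split=> [k|z Zz]; first by have [] := qP k.
have /almost_subsetP[n aBz] := aB _ (imageP B Zz).
exists n => k nk; have [kq aq _] := qP k.
have /asboolP[q' [qq' _]] := aBz _ (leq_trans nk kq) aq.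
by rewrite (pcan_inj pickleK qq').
Qed.

Definition gaps (h : nat -> nat) (t : cantor_space) :=
  forall e e', t e -> t e' -> (e < e')%N -> (h e <= e')%N.

Lemma thin_out (s : cantor_space) (h : nat -> nat) : inf_sets s ->
  exists t, [/\ inf_sets t, forall n, t n -> s n & gaps h t].
Proof.
move=> /infinite_natP infs.
have ex n : exists m, (maxn (h n) n.+1 <= m)%N /\ s m.
  by have [m] := infs (maxn (h n) n.+1); exists m.
have [f fP] := boolp.choice ex; have [e0 _ se0] := infs 0%N.
pose e n := iter n f e0.
have se n : s (e n) by case: n => // n; have [] := fP (e n).
have eS n : (maxn (h (e n)) (e n).+1 <= e n.+1)%N by have [] := fP (e n).
have e_homo : {homo e : m n / (m < n)%N}.
  apply: homo_ltn => [? ? ?|n]; first exact: ltn_trans.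
  by apply: leq_trans (eS n); rewrite leq_maxr.
have e_mono : {mono e : m n / (m <= n)%N} by apply: leq_mono.
exists (fun k => `[< exists n, k = e n >]); split.
- apply/infinite_natP => n; exists (e n); last by apply/asboolP; exists n.
  by elim: n => // n IHn; exact: leq_ltn_trans IHn (e_homo _ _ (ltnSn n)).
- by move=> n /asboolP[m ->].
- move=> _ _ /asboolP[i ->] /asboolP[j ->]; rewrite (leqW_mono e_mono) => ij.
  apply: leq_trans (leq_trans (leq_maxl _ _) (eS i)) _.
  by rewrite e_mono.
Qed.

(** This is [{2 n, 2 n + 1 | n in t}], which leaves room for one free bit at each element of [t]. *)
Definition dbl (t : cantor_space) : cantor_space := fun n => t n./2.

(** [t] thins out a pseudointersection of [F]. As the finite sets are among the points, some term of
    the gamma-sequence contains all of [below (2 * e).+2]. The gap after [e] exceeds the depth of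
    that term, which for large [e] therefore cannot tell [x] from [cut (2 * e).+2 x]. *)
Lemma stage (F Z : set cantor_space) (h : nat -> nat)
    (W : set (nat * seq (seq bool))) :
  F `<=` inf_sets -> centered F -> ~ (pseudointersection_number #<= F) ->
  ~ (pseudointersection_number #<= Z `|` fin_sets) ->
  exists t, [/\ inf_sets t, forall b, F b -> almost_subset t b, gaps h t &
    omega_codes (Z `|` fin_sets) W ->
    exists p, [/\ forall k, W (p k),
      forall z, (Z `|` fin_sets) z -> eventually_in p z &
      forall x, almost_subset x (dbl t) -> eventually_in p x]].
Proof.
move=> Finf Fc Fsmall Zsmall.
have [s [infs sF]] := pseudointersection_exists Finf Fc Fsmall.
have sub (t : cantor_space) : (forall n, t n -> s n) -> forall b, F b ->
  almost_subset t b.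
  move=> ts b /sF /almost_subsetP[n sb]; apply/almost_subsetP.
  by exists n => k nk /ts; exact: sb.
have [WZ|nWZ] := pselect (omega_codes (Z `|` fin_sets) W); last first.
  by have [t [inft ts ht]] := thin_out h infs; exists t; split => //;
    exact: sub.
have [|p [Wp pZ]] := small_gamma _ Zsmall WZ.
  by exists point; right; apply/finite_natP; exists 0%N.
(* The bound [e <= n] makes the selected indices tend to infinity, so points of [Z] stay eventually
   captured. *)
have ex e : exists n, (e <= n)%N /\ below (2 * e).+2 `<=` clopen_of (p n).
  have [|n nP] := eventually_finite (finite_below (2 * e).+2) (P :=
    fun k => clopen_of (p k)).
    by move=> x /below_fin xf; apply: pZ; right.
  by exists (maxn e n); split; [rewrite leq_maxl | apply: nP; rewrite leq_maxr].
have [k kP] := boolp.choice ex.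
pose H e := maxn (h e) (p (k e)).1.
have [t [inft ts Ht]] := thin_out H infs.
exists t; split=> //; first exact: sub.
  by move=> e e' te te' ee'; apply: leq_trans (Ht _ _ te te' ee');
    rewrite leq_maxl.
move=> _; move: inft => /infinite_natP inft.
have {}ex n : exists e, (n <= e)%N /\ t e by have [e] := inft n; exists e.
have [e eP] := boolp.choice ex.
exists (fun n => p (k (e n))); split=> [n|z /pZ[n nP]|x /almost_subsetP[M xt]].
- exact: Wp.
- exists n => i ni; apply: nP; apply: leq_trans ni _.
  by have [+ _] := eP i; have [+ _] := kP (e i); move=> a b; exact: leq_trans a.
- exists M => i Mi; have [ie te] := eP i; have [_ kPi] := kP (e i).
  apply: (determined_clopen_of _ (kPi _ (@cut_below _ x))) => j jd.
  rewrite /cut; case: ltnP => //= ej; apply/esym/negP => xj.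
  have tj : t j./2 by apply: xt xj; lia.
  have := Ht _ _ te tj; rewrite geq_max => /(_ _)/andP[]; first by lia.
  by move=> _; lia.
Qed.

(** * The tower *)

(* If [t = {t_0 < t_1 < ...}], this is [{2 t_n + y_n | n}]. *)
Definition encode (y t : cantor_space) : cantor_space :=
  fun n => t n./2 && (odd n == y (count t (iota 0 n./2))).

Lemma encode_dbl y t : almost_subset (encode y t) (dbl t).
Proof. by apply/almost_subsetP; exists 0%N => k _ /andP[]. Qed.

Lemma dbl_almost_subset t u : almost_subset t u ->
  almost_subset (dbl t) (dbl u).
Proof.
move=> /almost_subsetP[n tu]; apply/almost_subsetP; exists n.*2 => k nk.
by apply: tu; lia.
Qed.

Lemma count_iotaS (a : pred nat) n :
  count a (iota 0 n.+1) = (count a (iota 0 n) + a n)%N.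
Proof. by rewrite -addn1 iotaD count_cat /= add0n addn0. Qed.

Lemma count_encode y t k :
  count (encode y t) (iota 0 k.*2) = count t (iota 0 k).
Proof.
elim: k => // k IHk; rewrite doubleS !count_iotaS IHk /encode /=.
rewrite odd_double doubleK uphalf_double /=.
by case: (t k); case: (y _); rewrite ?addn0.
Qed.

(** The [n]-th element is [2 t_n + y_n], since exactly [n] elements lie below it. *)
Lemma odd_enum_encode y t n : inf_sets t ->
  odd (enum_elems (encode y t) n) = y n.
Proof.
move=> /(enum_elemsP n)[]; set k := enum_elems t n => tk kn.
have ek : encode y t (k.*2 + y n).
  have ke : (k.*2 + y n)./2 = k by case: (y n); lia.
  by rewrite /encode ke tk kn /= oddD odd_double oddb.
suff cn : count (encode y t) (iota 0 (k.*2 + y n)) = n.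
  by rewrite -[n in LHS]cn enum_elems_count // oddD odd_double oddb addFb.
case yn : (y n); rewrite ?addn0 ?addn1 ?count_iotaS count_encode kn //.
by rewrite /encode odd_double doubleK kn yn andbF addn0.
Qed.

Lemma inf_encode y t : inf_sets t -> inf_sets (encode y t).
Proof.
move=> /infinite_natP inft; apply/infinite_natP => n; have [k nk tk] := inft n.
pose b := y (count t (iota 0 k)).
have kb : (k.*2 + b)./2 = k by rewrite /b; case: (y _); lia.
exists (k.*2 + b)%N; first by lia.
by rewrite /elems /mkset /encode kb tk oddD odd_double oddb /b eqxx.
Qed.

(** Among finitely many members of the chain one is almost contained in all the others, and that one
    is infinite. *)
Lemma centered_chain (T : Type) (lt : T -> T -> Prop) (t : T -> cantor_space)
    (A : set T) :
  (forall i j, [\/ lt i j, i = j | lt j i]) ->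
  (forall i, A i -> inf_sets (t i)) ->
  (forall i j, A i -> lt j i -> almost_subset (t i) (t j)) ->
  centered (t @` A).
Proof.
move=> tot inft dec G GA finG.
have [->|/set0P[g0 Gg0]] := eqVneq G set0.
  by rewrite bigcap_set0; exact: infinite_nat.
suff [m Am Gm] : exists2 i, A i & forall g, G g -> almost_subset (t i) g.
  have [n nG] := @eventually_finite _ _ (fun k (g : cantor_space) => t m k -> g
    k) finG
    (fun g Gg => (almost_subsetP _ _).1 (Gm g Gg)).
  have /infinite_natP infm := inft _ Am; apply/infinite_natP => M.
  have [k] := infm (maxn n M); rewrite geq_max => /andP[nk Mk] tk.
  by exists k => // g Gg; exact: nG.
have [a0 Aa0 _] := GA _ Gg0.
move: finG => /finite_seqP[s Gs]; move: GA; rewrite Gs;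
  elim: s {Gs Gg0} => [|g s IHs] sA.
  by exists a0.
have [|i Ai iP] := IHs.
  by move=> b bs; apply: sA; rewrite /= inE (bs : b \in s) orbT.
have [j Aj jg] := sA g (mem_head g s).
have refl u : almost_subset u u by apply/almost_subsetP; exists 0%N.
have [ij|ij|ji] := tot i j.
- exists j => // b; rewrite /= inE => /orP[/eqP ->|bs]; first by rewrite -jg.
  by apply: almost_subset_trans (iP b bs); exact: dec.
- exists j => // b; rewrite /= inE => /orP[/eqP ->|bs]; first by rewrite -jg.
  by rewrite -ij; exact: iP.
- exists i => // b; rewrite /= inE => /orP[/eqP ->|bs]; first by rewrite -jg;
  exact: dec.
  exact: iP.
Qed.

Lemma tower_exists : pseudointersection_number #= continuum ->
  exists X : set cantor_space,
  [/\ X `<=` inf_sets,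
      forall y : cantor_space, exists2 x, X x & forall n,
        odd (enum_elems x n) = y n &
      forall (h : nat -> nat) (W : set (nat * seq (seq bool))),
        exists t S, [/\ S `<=` X /\ ~ (continuum #<= S), inf_sets t, gaps h t,
          forall x, (X `\` S) x -> almost_subset x (dbl t) &
          omega_codes (X `|` fin_sets) W ->
            exists p, (forall k, W (p k)) /\
              forall z, (X `|` fin_sets) z -> eventually_in p z]].
Proof.
move=> pc.
have p_small (A : set cantor_space) : ~ (continuum #<= A) ->
  ~ (pseudointersection_number #<= A).
  by move=> + pA; apply; rewrite -(card_le_eql pc).
have [lt [lt_wf lt_trans lt_tot lt_small]] := continuum_well_order.
have [dec decP] := code_surjective (nat * nat + nat * seq (seq bool) +
  nat)%type.
pose hof c n : nat := get [set m | dec c (inl (inl (n, m)))].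
pose Wof c : set (nat * seq (seq bool)) := [set q | dec c (inl (inr q))].
pose yof c : cantor_space := fun n => dec c (inr n).
have codeP h W y : exists c, [/\ hof c = h, Wof c = W & yof c = y].
  have [c cE] := decP (fun k => match k with
    | inl (inl (n, m)) => h n == m | inl (inr q) => `[< W q >] | inr n => y n
      end).
  exists c; split; apply/funext => n; rewrite /hof /Wof /yof /mkset cE //.
    by apply: xget_unique => [|m /eqP ->]; rewrite //=.
  exact: asboolE.
pose Zof (t : cantor_space -> cantor_space) c :=
  [set encode (yof d) (t d) | d in [set d | lt d c]].
pose G c (t : cantor_space -> cantor_space) u :=
  [/\ inf_sets u, forall d, lt d c -> almost_subset u (t d), gaps (hof c) u &
    omega_codes (Zof t c `|` fin_sets) (Wof c) ->
    exists p, [/\ forall k, Wof c (p k),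
      forall z, (Zof t c `|` fin_sets) z -> eventually_in p z &
      forall x, almost_subset x (dbl u) -> eventually_in p x]].
have [] := @wf_choice _ cantor_space lt G lt_wf.
- move=> c f g u fg [infu uf gu om].
  have Zfg : Zof f c = Zof g c.
    by apply/seteqP; split=> _ [d dc <-]; exists d => //; rewrite fg.
  by split=> //; rewrite -?Zfg // => d dc; rewrite -fg //; exact: uf.
- move=> c f IH.
  have finf : f @` [set d | lt d c] `<=` inf_sets.
    by move=> _ [d dc <-]; have [] := IH d dc.
  have fcent : centered (f @` [set d | lt d c]).
    apply: (centered_chain lt_tot) => [d|d e] /IH[] //.
    by move=> _ + _ _; exact.
  have fsmall : ~ (pseudointersection_number #<= f @` [set d | lt d c]).
    by apply: p_small => h; apply: (lt_small c);
      exact: card_le_trans h (card_image_le _ _).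
  have Zsmall : ~ (pseudointersection_number #<= Zof f c `|` fin_sets).
    apply: p_small => /(card_continuumU countable_fin_sets) h;
      apply: (lt_small c).
    exact: card_le_trans h (card_image_le _ _).
  have [u [infu uF gu uZ]] := stage (hof c) (Wof c) finf fcent fsmall Zsmall.
  by exists u; split=> // d dc; apply: uF; exists d.
move=> t tP.
pose x c := encode (yof c) (t c).
exists (range x); split.
- by move=> _ [c _ <-]; apply: inf_encode; have [] := tP c.
- move=> y; have [c [_ _ yc]] := codeP (fun=> 0%N) set0 y.
  exists (x c); first by exists c.
  by move=> n; rewrite odd_enum_encode ?yc //; have [] := tP c.
- move=> h W; have [c [hc Wc _]] := codeP h W point.
  have [inft tdec gt tW] := tP c.
  have xt d : ~ lt d c -> almost_subset (x d) (dbl (t c)).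
    move=> ndc; apply: almost_subset_trans (encode_dbl _ _) _.
    have [//|->|cd] := lt_tot d c; first by apply/almost_subsetP; exists 0%N.
    by apply: dbl_almost_subset; have [_ + _ _] := tP d; exact.
  exists (t c), (Zof t c); split=> //.
  + split=> [_ [d _ <-]|h']; first by exists d.
    by apply: (lt_small c); exact: card_le_trans h' (card_image_le _ _).
  + by rewrite -hc.
  + move=> _ [[d _ <-] nZ]; apply: xt => dc; apply: nZ; exists d => //.
  (* The omega property restricts to the earlier points; the resulting sequence captures those by
     [pZ] and the points from stage [c] on by [px]. *)
  + rewrite -Wc => om; have [|p [Wp pZ px]] := tW.
      move=> E finE EZ; apply: om => // z /EZ[[d _ <-]|]; last by right.
      by left; exists d.
    exists p; split=> // z [[d _ <-]|zf]; last by apply: pZ; right.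
    have [dc|ndc] := pselect (lt d c); last exact/px/xt.
    by apply: pZ; left; exists d.
Qed.

(** * Null sets *)

Import Order.TTheory GRing.Theory Num.Theory.

Lemma determined_bigsetU (I : Type) (r : seq I) (P : pred I) (F : I ->
  set cantor_space) :
  (forall i, exists n, determined n (F i)) ->
  exists n, determined n (\big[setU/set0]_(i <- r | P i) F i).
Proof.
move=> dF; elim/big_ind: _ => // [|A B [m dA] [n dB]]; first by exists 0%N.
exists (maxn m n); apply: determinedU.
  exact: determinedW (leq_maxl m n) dA.
exact: determinedW (leq_maxr m n) dB.
Qed.

Section null_sets.
Context (R : realType).
Local Open Scope ring_scope.
Local Open Scope ereal_scope.

Lemma fair_coinE (A : set cantor_space) : (exists n, determined n A) ->
  fair_coin R A = words_measure R A.
Proof. by move=> dA; rewrite /fair_coin /measure_extension measurable_mu_extE.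
  Qed.

(** Borel-Cantelli: the bounds sum to [c]. *)
Lemma null_limsup (D : nat -> set cantor_space) (c : R) : (0 <= c)%R ->
  (forall k, exists n, determined n (D k)) ->
  (forall k, words_measure R (D k) <= (c / (2 ^ k.+1)%:R)%:E) ->
  null R (lim_sup_set D).
Proof.
move=> c0 dD muD; exists (lim_sup_set D).
have mD k : measurable (D k : set (g_sigma_algebraType (@measurable
  coin_display coin_space))).
  by apply: sub_sigma_algebra; have [n dn] := dD k;
    exact: determined_measurable dn.
split=> //.
  apply: bigcap_measurable => // k _; exact: bigcup_measurable.
apply: (@lim_sup_set_cvg0 _ _ _ (measure_extension (words_measure R))) => //.
apply: le_lt_trans (ltry c); apply: le_trans (epsilon_trick0 xpredT c0).
apply: lee_nneseries => // k _.
by rewrite /= -[X in X <= _]/(fair_coin R (D k)) fair_coinE.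
Qed.

Lemma words_measure_bigsetU (I : Type) (r : seq I) (F : I ->
  set cantor_space) (c : R) :
  (forall i, exists n, determined n (F i)) ->
  (forall i, words_measure R (F i) <= c%:E) ->
  words_measure R (\big[setU/set0]_(i <- r) F i) <= ((size r)%:R * c)%:E.
Proof.
move=> dF muF; elim: r => [|i r IHr];
  first by rewrite big_nil words_measure0 mul0r.
rewrite big_cons /= -add1n natrD mulrDl mul1r EFinD.
apply: le_trans (leeD (muF i) IHr).
by apply: (@measureU2 _ _ _ (words_measure R)) => //; exact: determined_bigsetU.
Qed.

Lemma null_cover (Y : set cantor_space) (e : R) : null R Y -> (0 < e)%R ->
  exists F : nat -> set cantor_space, [/\ forall k, exists n,
    determined n (F k),
    Y `<=` \bigcup_k F k & \sum_(k <oo) words_measure R (F k) < e%:E].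
Proof.
move=> [A [mA A0 YA]] e0; have muA : (words_measure R)^*%mu A = 0 by exact: A0.
have [|x [F [mF AF] <-]] := @lb_ereal_inf_adherent R
    [set \sum_(k <oo) words_measure R (F k) | F in measurable_cover (A : set
      coin_space)] e e0.
  by rewrite -/(mu_ext _ _) muA.
rewrite -/(mu_ext _ _) muA add0e => ltFe.
by exists F; split=> //; apply: subset_trans AF.
Qed.

(** For each [i] cut a clopen cover of total measure below [16^-i] into finite blocks, the tail from
    block [k] on having measure at most [16^-k]. [D k] unites the [k]-th blocks of covers [0] to
    [k], and [(k + 1) 16^-k <= 8^-k]. Cover [n] places each point of [Y] in some [D k] with
    [k >= n]. *)
Lemma null_limsup_cover (Y : set cantor_space) : null R Y ->
  exists (D : nat -> set cantor_space) (f : nat -> nat),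
    [/\ {homo f : m n / (m <= n)%N}, forall k, determined (f k) (D k),
        forall k, words_measure R (D k) <= (8 ^- k)%:E & Y `<=` lim_sup_set D].
Proof.
move=> Y0.
have pos i : (0 < 16 ^- i :> R)%R by rewrite invr_gt0 exprn_gt0.
have [F FP] := boolp.choice (fun i => null_cover Y0 (pos i)).
have F_ge0 i k : 0 <= words_measure R (F i k) by exact: words_measure_ge0.
(* The first clause makes the cut points unbounded in [k]; the second starts block [i] of cover [i]
   at 0, so that the blocks [k >= i] miss no term. *)
have ex i k : exists n, [/\ (k <= n)%N \/ (k <= i)%N, (k <= i)%N -> n = 0%N &
    \sum_(n <= j <oo) words_measure R (F i j) <= (16 ^- k)%:E].
  have [_ _ Fi] := FP i.
  have [ki|ik] := leqP k i.
    exists 0%N; split=> //; first by right.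
    apply: le_trans (ltW Fi) _; rewrite lee_fin lef_pV2 ?posrE ?exprn_gt0 //.
    by rewrite ler_weXn2l // ler1n.
  have tail : (\sum_(n <= j <oo) words_measure R (F i j)) @[n --> \oo] --> 0.
    by apply: nneseries_tail_cvg => //; apply: lt_trans Fi (ltry _).
  have /tail[N _ NP] : nbhs (0 : \bar R) [set x | x < (16 ^- k)%:E].
    by apply: open_nbhs_nbhs; split;
      [exact: open_ereal_lt_ereal | rewrite /= lte_fin].
  exists (maxn N k); split; [by left; rewrite leq_maxr|by []|].
  by apply: ltW; apply: NP; rewrite /= leq_maxl.
have [J0 J0P] := boolp.choice (fun p => ex p.1 p.2).
pose J i k := J0 (i, k); have JP i k := J0P (i, k).
pose P k i := \big[setU/set0]_(j < J i k.+1 - J i k) F i (j + J i k)%N.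
pose D k := \big[setU/set0]_(i < k.+1) P k i.
have dP k i : exists n, determined n (P k i).
  by apply: determined_bigsetU => j; have [] := FP i.
have dD k : exists n, determined n (D k) by apply: determined_bigsetU => i.
have [g gP] := boolp.choice dD.
exists D, (fun k => \max_(i < k.+1) g i)%N; split.
- move=> m n mn; apply/bigmax_leqP => i _.
  have im : (i < n.+1)%N by apply: leq_trans (ltn_ord i) _.
  exact: (@leq_bigmax _ (fun i : 'I_n.+1 => g i) (Ordinal im)).
- move=> k; apply: determinedW (gP k).
  exact: (@leq_bigmax _ (fun i : 'I_k.+1 => g i) ord_max).
- move=> k.
  have muP i : words_measure R (P k i) <= (16 ^- k)%:E.
    have [_ _ Jik] := JP i k; apply: le_trans Jik.
    apply: le_trans (@nneseries_lim_ge _ _ xpredT (J i k) (J i k.+1) _) => //.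
    rewrite -{1}[J i k]add0n big_addn big_mkord.
    apply: (@le_mu_bigsetU _ _ _ (words_measure R) (fun j => F i (j + J i
      k)%N)) => j _.
    by have [dF _ _] := FP i; exact: dF.
  apply: le_trans (words_measure_bigsetU (index_enum 'I_k.+1) (fun i => dP k i)
    muP) _.
  have -> : size (index_enum 'I_k.+1) = k.+1 by rewrite -[RHS]card_ord cardT
    enumT.
  rewrite lee_fin ler_pdivrMr ?exprn_gt0 // -(natrX _ 16) -(natrX _ 8).
  rewrite mulrC ler_pdivlMr ?ltr0n ?expn_gt0 //.
  rewrite -natrM ler_nat (_ : 16 = 8 * 2)%N // expnMn mulnC leq_mul2l.
  by rewrite (ltn_expl k (isT : 1 < 2)%N) orbT.
- move=> y Yy n _ /=.
  have [_ /(_ y Yy)[j _ Fj] _] := FP n.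
  (* [J n] need not be monotone, so the block containing [j] is located by minimality of [k]. *)
  have [k Jk kmin] : exists2 k, (n <= k)%N && (j < J n k.+1)%N &
      forall k', (n <= k')%N && (j < J n k'.+1)%N -> (k <= k')%N.
    have exk : exists k, (n <= k)%N && (j < J n k.+1)%N.
      exists (n + j)%N; rewrite leq_addr /=.
      by have [[|]+ _ _] := JP n (n + j).+1; rewrite /J /=; lia.
    by case: (ex_minnP exk) => k Jk kmin; exists k.
  move: Jk => /andP[nk jJ]; exists k => //.
  have Jj : (J n k <= j)%N.
    case: k nk jJ kmin => [|k] nk jJ kmin.
      by have [_ /(_ (leq0n n)) + _] := JP n 0%N; rewrite /J => ->.
    move: nk; rewrite leq_eqVlt => /orP[/eqP nk|nk].
      by have [_ + _] := JP n k.+1; rewrite /J /= -nk => ->.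
    rewrite leqNgt; apply/negP => jlt.
    by have := kmin k; rewrite jlt -ltnS nk => /(_ isT); rewrite ltnn.
  rewrite /D -(bigcup_mkord k.+1 (P k)); exists n => //=.
  rewrite /P -(bigcup_mkord _ (fun j => F n (j + J n k)%N)).
  by exists (j - J n k)%N; rewrite /= ?subnK // ltn_sub2r // (leq_ltn_trans Jj).
Qed.

End null_sets.

(** * Sums with sparse sets *)

Definition translate (z : cantor_space) (D : set cantor_space) :
    set cantor_space :=
  [set x | D (symdiff z x)].

Lemma determined_translate n z D : determined n D ->
  determined n (translate z D).
Proof. by move=> dD x y xy; apply: dD => i ni; rewrite /symdiff xy. Qed.

Lemma words_translate n z D : determined n D ->
  words (translate z D) n = words D n.
Proof.
move=> dD; pose g (s : n.-tuple bool) := mktuple (fun i => z i (+) tnth s i).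
have gK : involutive g.
  by move=> s; apply: eq_from_tnth => i; rewrite !tnth_mktuple addKb.
rewrite /words -[RHS](card_preimset _ (inv_inj gK)); apply: eq_card => s.
have gs i : (i < n)%N -> symdiff z (pad s) i = pad (g s) i.
  move=> ni; rewrite /symdiff /pad.
  by rewrite -[i]/(nat_of_ord (Ordinal ni)) -!tnth_nth tnth_mktuple.
by rewrite !inE; apply/asboolP/asboolP; apply: dD => i ni; rewrite gs.
Qed.

Lemma words_measure_translate (R : realType) n z D : determined n D ->
  words_measure R (translate z D) = words_measure R D.
Proof.
by move=> dD; rewrite !(@words_measureE R n) ?words_translate //;
  exact: determined_translate.
Qed.

Lemma size_index_enum (T : finType) : size (index_enum T) = #|T|.
Proof. by rewrite cardT enumT. Qed.

(* If [e] is the least element of [t] with [k <= e], then [dbl t] has at most two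
   elements between [2 k] and [2 e + 1], so there are [O(4^k)] candidates for
   the part of [x] below [2 e + 2], which determines [phi x] at the depth of [D k]; the bound
   [8^-k] absorbs this factor. *)
Lemma null_sparse_sum (R : realType) (A Y : set cantor_space)
    (phi : cantor_space -> cantor_space) (t : cantor_space) (h f : nat -> nat)
    (D : nat -> set cantor_space) :
  {homo f : m n / (m <= n)%N} -> (forall k, determined (f k) (D k)) ->
  (forall k, words_measure R (D k) <= (8 ^- k)%:E)%E -> Y `<=` lim_sup_set D ->
  inf_sets t -> gaps h t ->
  (forall e s x, below (2 * e).+2 s -> A x ->
    (forall i, (i < h e)%N -> x i = s i) ->
    forall i, (i < f e)%N -> phi x i = phi s i) ->
  (forall x, A x -> almost_subset x (dbl t)) ->
  null R [set symdiff (phi x) y | x in A & y in Y].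
Proof.
move=> f_homo dD muD YD /infinite_natP inft ht modulus At.
have ex k : exists e, [/\ (k <= e)%N, t e & forall e', (k <= e')%N ->
  t e' -> (e <= e')%N].
  have exe : exists e, (k <= e)%N && t e by have [e ke te] := inft k;
    exists e; rewrite ke.
  have [e /andP[ke te] emin] := ex_minnP exe; exists e; split=> // e' ke' te'.
  by apply: emin; rewrite ke'.
have [e eP] := boolp.choice ex.
(* If [x] lies in [dbl t] from [M] on, these are the only positions below [2 e_k + 2] where [x] can
   be nonzero. *)
pose pos M k := iota 0 (M + k.*2) ++ [:: (e k).*2; (e k).*2.+1].
pose supp M k (b : seq bool) : cantor_space :=
  fun i => (i \in pos M k) && nth false b (index i (pos M k)).
pose G M k := \big[setU/set0]_(b <- index_enum ((M + k.*2 + 2).-tuple bool))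
  translate (phi (supp M k b)) (D k).
have dG M k (b : (M + k.*2 + 2).-tuple bool) :
    exists n, determined n (translate (phi (supp M k b)) (D k)).
  by exists (f k); exact: determined_translate.
have nullG M : null R (lim_sup_set (G M)).
  (* There are [2^(M + 2k + 2)] candidates of measure at most [8^-k], and
     [2^(M + 2 - k) = 2^(M + 3) / 2^(k + 1)]. *)
  apply: (@null_limsup _ _ (2 ^ (M + 3))%:R) => // k.
    exact: determined_bigsetU (@dG M k).
  apply: le_trans (words_measure_bigsetU _ (@dG M k) _) _.
    by move=> b; rewrite (@words_measure_translate _ (f k));
      [exact: muD|exact: dD].
  rewrite size_index_enum card_tuple card_bool lee_fin.
  rewrite ler_pdivlMr ?ltr0n ?expn_gt0 // mulrAC ler_pdivrMr ?exprn_gt0 //.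
  rewrite -(natrX _ 8) -!natrM ler_nat -(expnM 2 3) -!expnD leq_exp2l //; lia.
apply: (@negligibleS _ _ _ (measure_extension (words_measure R))
  (\bigcup_M lim_sup_set (G M))); last first.
  exact: (@negligible_bigcup _ _ _ (measure_extension (words_measure R)) _
    nullG).
move=> _ [x Ax [y Yy <-]].
have /almost_subsetP[M xt] := At x Ax.
exists M => // n _; have [k /=] := YD y Yy (maxn n M) I.
rewrite geq_max => /andP[nk Mk] Dky; exists k => //.
have [ke te emin] := eP k.
pose s := cut (2 * e k).+2 x.
have xs i : (i < f (e k))%N -> phi x i = phi s i.
  apply: modulus => // [|j jh]; first exact: cut_below.
  rewrite /s /cut; case: ltnP => //= ej; apply/negP => xj.
  have tj : t j./2 by apply: xt xj; lia.
  by have := ht _ _ te tj; lia.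
pose b := mktuple (fun j : 'I_(M + k.*2 + 2) => s (nth 0%N (pos M k) j)).
have sz : size (pos M k) = (M + k.*2 + 2)%N by rewrite size_cat size_iota.
have bE j : (j < M + k.*2 + 2)%N -> nth false b j = s (nth 0%N (pos M k) j).
  by move=> lt_j; rewrite -[j in LHS]/(nat_of_ord (Ordinal lt_j)) -tnth_nth
    tnth_mktuple.
have sE : supp M k b = s.
  apply/funext => i; rewrite /supp; case: (boolP (i \in pos M k)) => /= [ipos|].
    by rewrite bE ?nth_index // -sz index_mem.
  rewrite mem_cat mem_iota !inE !negb_or => /and3P[iM ie ie'].
  rewrite /s /cut; case: ltnP => //= ie2; apply/esym/negP => xi.
  have ti : t i./2 by apply: xt xi; lia.
  have := emin i./2; rewrite ti => /(_ _ isT); lia.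
rewrite /G (bigD1_seq b) /=; last 2 first.
- exact: mem_index_enum.
- exact: index_enum_uniq.
(* As [k <= e k] and [f] is monotone, [phi s] and [phi x] agree up to [f k], so adding [phi s] to
   the sum gives back [y] there. *)
left; rewrite /translate /= sE; apply: dD Dky => i ik.
by rewrite /symdiff -xs ?addKb // (leq_trans ik) // f_homo.
Qed.

(** * Covers, graphs and the theorem *)

Definition agree (n : nat) (x y : cantor_space) :=
  forall i, (i < n)%N -> x i = y i.

Lemma determined_agree n x : determined n [set y | agree n y x].
Proof. by move=> y z yz yx i ni; rewrite -yz // yx. Qed.

Lemma open_set_typeP (A : set cantor_space) (U : set (set_type A)) :
  open U <-> forall x, U x -> exists n, forall y : set_type A,
    agree n (set_val y) (set_val x) -> U y.
Proof.
split=> [[V oV <-] x Vx|Uex].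
  have [n nV] := open_cylinder oV Vx; exists n => y; exact: nV.
pose O := \bigcup_(p in [set p : set_type A * nat | forall y : set_type A,
    agree p.2 (set_val y) (set_val p.1) -> U y])
  [set z : cantor_space | agree p.2 z (set_val p.1)].
exists O.
  by apply: bigcup_open => p _; exact: determined_open (@determined_agree _ _).
apply/seteqP; split=> [x [p pU px]|x Ux]; first exact: pU.
by have [n nU] := Uex x Ux; exists (x, n).
Qed.

Lemma continuous_modulus (A : set cantor_space) (phi : set_type A ->
  cantor_space) n x :
  continuous phi -> exists m, forall y : set_type A,
    agree m (set_val y) (set_val x) -> agree n (phi y) (phi x).
Proof.
move=> /continuousP cphi.
have /cphi/open_set_typeP/(_ x) :=
  determined_open (@determined_agree n (phi x)).
by apply=> i.
Qed.

Lemma modulus_continuous (A B : set cantor_space) (F : set_type A ->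
  set_type B) :
  (forall x i, exists m, forall y : set_type A,
    agree m (set_val y) (set_val x) -> set_val (F y) i = set_val (F x) i) ->
  continuous F.
Proof.
move=> Fmod; apply/continuousP => U /open_set_typeP oU.
apply/open_set_typeP => x /oU[n nU].
have [|m mP] := @eventually_finite _ `I_n (fun m i => forall y : set_type A,
    agree m (set_val y) (set_val x) ->
      set_val (F y) i = set_val (F x) i) (finite_II n).
  move=> i _; have [m mP] := Fmod x i; exists m => k mk y yx; apply: mP => j jm.
  by rewrite yx // (leq_trans jm).
by exists m => y yx; apply: nU => i ni; exact: (mP m).
Qed.

(** By [clopen_between] the codes of clopen sets inside members of the cover have the omega
    property; members chosen around a gamma-sequence of codes form the gamma-cover. *)
Lemma gamma_of_codes (A : set cantor_space) :
  (forall W, omega_codes A W -> exists p, (forall k, W (p k)) /\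
     forall z, A z -> eventually_in p z) ->
  property_gamma (set_type A).
Proof.
move=> codesA U [[Uproper _] Uopen] [_ Uomega].
have [|p [Wp pA]] := codesA [set p | exists2 B, U B &
    forall x : set_type A, clopen_of p (set_val x) -> B x].
  move=> E finE EA.
  have [|B UB EB] := Uomega [set x : set_type A | E (set_val x)].
    by apply: finite_preimage => // x y _ _; exact: val_inj.
  have [V oV BV] := Uopen B UB.
  have [|p [Ep pV]] := clopen_between finE oV.
    move=> x Ex; have : B (SigSub (mem_set (EA x Ex))) by apply: EB.
    by rewrite -BV.
  exists p => //; exists B => // x /pV; by rewrite -BV.
have ex k : exists B, U B /\
    forall x : set_type A, clopen_of (p k) (set_val x) -> B x.
  by have [B UB pB] := Wp k; exists B.
have [B BP] := boolp.choice ex.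
have Bev (x : set_type A) : exists n, forall k, (n <= k)%N -> B k x.
  have [n nx] := pA _ (set_valP x).
  by exists n => k nk; have [_] := BP k; apply; exact: nx.
have BU k : U (B k) by have [] := BP k.
exists (range B); first by move=> _ [k _ <-].
split.
- split; first by move=> _ [k _ <-]; exact: Uproper.
  apply/seteqP; split=> // x _; have [n nx] := Bev x.
  by exists (B n); [exists n|exact: nx].
- (* If the [B k] were finitely many, one of them would occur infinitely often
     and hence contain every point. *)
  move=> finB.
  have [|n nB] := @eventually_finite _ (range B) (fun k b => B k <> b) finB.
    move=> b [j _ bj]; apply: contrapT => nb.
    have := Uproper b; rewrite -bj => /(_ (BU j)) /eqP; apply.
    apply/seteqP; split=> // x _; have [n nx] := Bev x.
    apply: contrapT => nbx; apply: nb; exists n => k nk Bk.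
    by apply: nbx; rewrite bj -Bk; exact: nx.
  exact: (nB n (leqnn n) (B n) (imageP B I)).
- move=> x; have [n nx] := Bev x.
  apply: sub_finite_set (finite_image B (finite_II n)) => _ [[k _ <-] nBx].
  by exists k => //=; rewrite ltnNge; apply/negP => /nx.
Qed.

(** * The graph of the parity map *)

Definition parities (x : cantor_space) : cantor_space :=
  fun n => odd (enum_elems x n).

(** This yields the continuity of [parities] on infinite sets. *)
Lemma enum_elems_agree (x y : cantor_space) n : inf_sets x ->
  agree (enum_elems x n).+1 y x -> enum_elems y n = enum_elems x n.
Proof.
move=> /(enum_elemsP n)[]; set k := enum_elems x n => xk xn yx.
rewrite -xn (_ : count x _ = count y (iota 0 k)).
  by rewrite enum_elems_count // yx.
by apply: eq_in_count => i; rewrite mem_iota add0n => /= ik; rewrite yx // ltnW.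
Qed.

Lemma homeomorphic_graph (X : set cantor_space) : X `<=` inf_sets ->
  homeomorphic (set_type X)
    (set_type [set interleave x (parities x) | x in X]).
Proof.
move=> Xinf; set f := fun x => interleave x (parities x);
  set Y := [set f x | x in X].
pose even (y : cantor_space) : cantor_space := fun n => y n.*2.
have evenK x : even (f x) = x by apply/funext => n; exact: interleave_even.
have evenY y : Y y -> X (even y) by move=> [x Xx <-]; rewrite evenK.
have fX x : X x -> Y (f x) by move=> Xx; exists x.
pose F (x : set_type X) : set_type Y := SigSub (mem_set (fX _ (set_valP x))).
pose G (y : set_type Y) : set_type X := SigSub (mem_set (evenY _ (set_valP y))).
exists F, G; split.
- apply: modulus_continuous => x i.
  have [m mP] : exists m, forall y : cantor_space, agree m y (set_val x) ->
    f y i = f (set_val x) i.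
    rewrite /f /interleave; case: (odd i).
      exists (enum_elems (set_val x) i./2).+1 => y yx.
      by rewrite /parities (enum_elems_agree _ yx) //; exact/Xinf/set_valP.
    by exists i./2.+1 => y yx; exact: yx.
  by exists m => y /mP.
- apply: modulus_continuous => y i; exists i.*2.+1 => z zy; exact: zy.
- by move=> x; apply: val_inj; exact: evenK.
- move=> y; apply: val_inj; have [x Xx fxy] := set_valP y.
  by change (f (even (val y)) = val y); rewrite -fxy evenK.
Qed.

(** Zeros at the odd positions below [2 k] leave [2^k] of the [4^k] words, of total measure [2^-k],
    and Borel-Cantelli applies. *)
Lemma null_even (R : realType) : null R [set z | forall n, z n.*2.+1 = false].
Proof.
pose w k (b : k.-tuple bool) := mkseq (interleave (pad b) (fun=> false)) k.*2.
pose C k b := [set x : cantor_space | forall i, (i < size (@w k b))%N ->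
  x i = nth false (w k b) i].
have dC k b : determined k.*2 (C k b).
  move=> x y xy Cx i; rewrite size_mkseq => ik.
  by rewrite -xy // Cx // size_mkseq.
pose D k := \big[setU/set0]_(b <- index_enum (k.-tuple bool)) C k b.
apply: (@negligibleS _ _ _ (measure_extension (words_measure R)) (lim_sup_set
  D)).
  move=> z z0 n _; exists n; rewrite /= ?leqnn //.
  pose b := mktuple (fun i : 'I_n => z i.*2).
  rewrite /D (bigD1_seq b) /=; last 2 first.
  - exact: mem_index_enum.
  - exact: index_enum_uniq.
  left => i; rewrite size_mkseq => ni; rewrite nth_mkseq // /interleave.
  case: ifPn => [oi|ei]; first by rewrite -(z0 i./2); congr z; lia.
  have i2n : (i./2 < n)%N by lia.
  rewrite /pad -[i./2]/(nat_of_ord (Ordinal i2n)) -tnth_nth tnth_mktuple /=.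
  by congr z; lia.
apply: (@null_limsup _ _ 2) => // k.
  by apply: determined_bigsetU => b; exists k.*2; exact: dC.
apply: le_trans (@words_measure_bigsetU _ _ _ _ (2 ^- k.*2)%R _ _) _ => [b|b|].
- by exists k.*2.
- rewrite -fair_coinE; last by exists k.*2.
  by rewrite fair_coin_cylinder size_mkseq.
- rewrite size_index_enum card_tuple card_bool lee_fin -mul2n mulnC exprM.
  rewrite natrX expr2 invfM mulrA mulfV ?mul1r ?expf_neq0 //.
  by rewrite natrX exprS invfM mulrA mulfV ?mul1r.
Qed.

Lemma non_null_setT (R : realType) : ~ null R [set: cantor_space].
Proof.
move=> [A [_ A0 TA]]; have {TA}AT : A = setT by apply/seteqP; split.
have := fair_coin_cylinder R [::]; rewrite (_ : [set _ | _] = A).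
  rewrite -[X in X = _]/(measure_extension (words_measure R) A).
  rewrite (A0 : measure_extension _ A = 0%E) /= expr0 invr1 => /eqP.
  by rewrite eqe eq_sym oner_eq0.
by rewrite AT; apply/seteqP; split.
Qed.

(** The odd coordinates of the graph already take all values, and adding the null set of [null_even]
    makes the even ones arbitrary, so the sum is everything. *)
Lemma graph_not_null_additive (R : realType) (X : set cantor_space) :
  (forall y : cantor_space, exists2 x, X x & parities x = y) ->
  ~ null_additive R [set interleave x (parities x) | x in X].
Proof.
move=> surj /(_ _ (null_even R));
  rewrite (_ : [set _ | _ in _ & _ in _] = setT).
  exact: non_null_setT.
apply/seteqP; split=> // w _.
have [x Xx xw] := surj (fun n => w n.*2.+1).
exists (interleave x (parities x)); first by exists x.
exists (interleave (symdiff x (fun n => w n.*2)) (fun=> false)).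
  by move=> n; rewrite interleave_odd.
apply/funext => i; rewrite /symdiff /interleave xw; case: ifPn => oi.
  by rewrite addbF; congr w; lia.
by rewrite addKb; congr w; lia.
Qed.

Lemma generalized_tower (X : set cantor_space) :
  X `<=` inf_sets -> pseudointersection_number #<= X ->
  (forall h, exists t S, [/\ S `<=` X, ~ (pseudointersection_number #<= S),
     inf_sets t, gaps h t & forall x, (X `\` S) x ->
       almost_subset x (dbl t)]) ->
  p_generalized_tower X.
Proof.
move=> Xinf pX sparse; split=> // a infa.
(* For [e] in [t], block [2 e + 2] of [a] starts at or after [2 e + 2], past the doubling of [e],
   and ends at [enum_elems a (2 * e).+3], no later than the next element of [t]. So it misses
   [dbl t]. *)
have [t [S [SX Ssmall /infinite_natP inft ht Xt]]] :=
  sparse (fun e => enum_elems a (2 * e).+3).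
pose b : cantor_space := fun n =>
  `[< forall i, (enum_elems a n <= i < enum_elems a n.+1)%N -> ~~ dbl t i >].
exists b, S; split=> //.
  apply/infinite_natP => N; have [e Ne te] := inft N.
  exists (2 * e).+2; first by lia.
  apply/asboolP => i /andP[ai ia]; apply/negP => ti.
  have [_ cnt] := enum_elemsP (2 * e).+2 infa.
  have := count_size a (iota 0 (enum_elems a (2 * e).+2)).
  rewrite cnt size_iota => le2.
  have ei : (e < i./2)%N by lia.
  by have /= := ht _ _ te ti ei; lia.
move=> x /Xt /almost_subsetP[M xt]; apply/finite_natP;
  exists M => i [xi [n /asboolP bn ni]].
rewrite ltnNge; apply/negP => Mi.
by have := bn i ni; rewrite xt.
Qed.

(** The image of [S] is no larger than [S], hence null-additive; all other points, finite sets
    included, are almost contained in [dbl t], where [null_sparse_sum] applies. *)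
Lemma images_null_additive (R : realType) (X : set cantor_space) :
  (forall h, exists t S, [/\ forall S', S' #<= S -> null_additive R S',
     inf_sets t, gaps h t & forall x, (X `\` S) x ->
       almost_subset x (dbl t)]) ->
  forall phi : set_type (X `|` fin_sets) -> cantor_space,
    continuous phi -> null_additive R (range phi).
Proof.
move=> sparse phi cphi Y Y0.
have [D [f [f_homo dD muD YD]]] := null_limsup_cover Y0.
pose phi' (x : cantor_space) : cantor_space :=
  if pselect ((X `|` fin_sets) x) is left Ax then phi (SigSub (mem_set Ax))
    else point.
have phi'E (x : set_type (X `|` fin_sets)) : phi' (set_val x) = phi x.
  rewrite /phi'; case: pselect => [Ax|[]]; last exact: set_valP.
  by congr phi; apply: val_inj.
(* Only finitely many points lie in [below (2 * e).+2], so one modulus of continuity serves all of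
   them; it prescribes the gap after [e]. *)
have ex e : exists m, forall s x, below (2 * e).+2 s -> (X `|` fin_sets) x ->
    agree m x s -> agree (f e) (phi' x) (phi' s).
  have [|m mP] := eventually_finite (finite_below (2 * e).+2) (P := fun m s =>
      forall x, (X `|` fin_sets) x -> agree m x s ->
        agree (f e) (phi' x) (phi' s)).
    move=> s /below_fin fs; have As : (X `|` fin_sets) s by right.
    have [m mP] := continuous_modulus (f e) (SigSub (mem_set As)) cphi.
    exists m => k mk x Ax xs.
    rewrite -[x]/(set_val (SigSub (mem_set Ax))) -[s]/(set_val (SigSub (mem_set
      As))).
    by rewrite !phi'E; apply: mP => i im; apply: xs; exact: leq_trans im mk.
  by exists m => s x s2 Ax; exact: mP.
have [h hP] := boolp.choice ex.
have [t [S [Snull inft ht Xt]]] := sparse h.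
apply: (@negligibleS _ _ _ (measure_extension (words_measure R))
  ([set symdiff x y | x in phi' @` S & y in Y] `|`
   [set symdiff (phi' x) y | x in (X `\` S) `|` fin_sets & y in Y])).
  move=> _ [_ [x _ <-] [y Yy <-]]; rewrite -phi'E.
  have [Sx|nSx] := pselect (S (set_val x)).
    by left; exists (phi' (set_val x)); [exists (set_val x)|exists y].
  right; exists (set_val x); last by exists y.
  by have [Xx|?] := set_valP x; [left|right].
apply: (@negligibleU _ _ _ (measure_extension (words_measure R))).
  by apply: Snull Y0; exact: card_image_le.
apply: (null_sparse_sum f_homo dD muD YD inft ht).
  by move=> e s x s2 [[Xx _]|fx] xs; apply: hP => //; [left|right].
move=> x [/Xt //|/fin_below[n xn]]; apply/almost_subsetP; exists n => k nk /xn.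
by rewrite ltnNge nk.
Qed.

Theorem theorem2p2 (R : realType) :
  pseudointersection_number #= non_null_additive R ->
  non_null_additive R #= continuum ->
  exists X : set cantor_space, X `<=` inf_sets /\
    [/\ p_generalized_tower X,
        property_gamma (set_type (X `|` fin_sets)),
        (forall phi : set_type (X `|` fin_sets) -> cantor_space,
           continuous phi -> null_additive R (range phi)) &
        exists Y : set cantor_space,
          homeomorphic (set_type X) (set_type Y) /\ ~ null_additive R Y].
Proof.
move=> pn nc; have pc := card_eq_trans pn nc.
have [X [Xinf Xsurj Xsparse]] := tower_exists pc.
have par (y : cantor_space) : exists2 x, X x & parities x = y.
  by have [x Xx xy] := Xsurj y; exists x => //; apply/funext => n; exact: xy.
exists X; split=> //; split.
- apply: generalized_tower => // [|h].
    rewrite (card_le_eql pc); apply: card_le_trans (card_image_le parities X).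
    by apply: subset_card_le => y _; have [x Xx <-] := par y; exists x.
  have [t [S [[SX Ssmall] inft ht Xt _]]] := Xsparse h set0.
  by exists t, S; split=> //; rewrite (card_le_eql pc).
- apply: gamma_of_codes => W om.
  by have [t [S [_ _ _ _ /(_ om)]]] := Xsparse (fun=> 0%N) W.
- apply: images_null_additive => h.
  have [t [S [[_ Ssmall] inft ht Xt _]]] := Xsparse h set0.
  exists t, S; split=> // S' S'S; apply: contrapT => nS'.
  apply: Ssmall; rewrite -(card_le_eql nc); apply: card_le_trans S'S.
  exact: min_card_le.
- exists [set interleave x (parities x) | x in X]; split.
    exact: homeomorphic_graph.
  exact: graph_not_null_additive.
Qed.
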